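(* Fix integers $A,D\ge0$ and a nonempty finite alphabet $\mathcal X$, and let $\Theta_{\mathrm{ex}}(A,D)$ be the class of all stationary processes $P$ over $\mathcal X$ generated by an exact finite-state generator $\epsilon$-machine $G_P$ with $L_{\mathrm{tar}}(G_P)\le A$ and $L_{\mathrm{sep}}(G_P)\le D$. Consider the summaries $C_{L,R}$ with $L,R\ge1$. Then each of $$C_{2A+1,\,\max\{1,D\}},\qquad C_{\max\{1,2A\},\,D+1}$$ gives uniform identifiability on $\Theta_{\mathrm{ex}}(A,D)$, and the block law of length $2A+D+1$ also gives uniform identifiability on $\Theta_{\mathrm{ex}}(A,D)$. That is, for all $P,Q\in\Theta_{\mathrm{ex}}(A,D)$, each one of the three equalities $$C_{2A+1,\max\{1,D\}}(P)=C_{2A+1,\max\{1,D\}}(Q),\quad C_{\max\{1,2A\},D+1}(P)=C_{\max\{1,2A\},D+1}(Q),\quad P_{2A+D+1}=Q_{2A+D+1}$$ implies $G_P\cong G_Q$.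
   Context: Words. $\mathcal X$ is a nonempty finite alphabet, $\mathcal X^m$ the words of length $m$, $\mathcal X^*$ all finite words, $\lambda$ the empty word; $X_i^j=(X_i,\dots,X_j)$. Generator. A finite-state generator $\epsilon$-machine over $\mathcal X$ is $G=(\mathcal S,\pi,\delta,\{e_\sigma\}_{\sigma\in\mathcal S})$ where: (1) $\mathcal S$ is a nonempty finite set of states and each $e_\sigma$ is a probability mass function on $\mathcal X$; (2) a pair $(\sigma,x)$ is admissible when $e_\sigma(x)>0$, and a successor $\delta(\sigma,x)\in\mathcal S$ is defined exactly on admissible pairs; (3) the directed graph of positive-probability labeled transitions $\sigma\to\delta(\sigma,x)$ is strongly connected; (4) for $\sigma\neq\tau$ there is a word $w\in\mathcal X^*$ with $p_\sigma(w)\neq p_\tau(w)$, where $p_\sigma(w)=P(X_1^{|w|}=w\mid S_0=\sigma)$ (so $p_\sigma(\lambda)=1$); (5) $\pi$ is the unique probability vector with $\pi T=\pi$, where $T_{\sigma\tau}=\sum_{x:\,e_\sigma(x)>0,\ \delta(\sigma,x)=\tau}e_\sigma(x)$. The dynamics are $P(X_{t+1}=x,S_{t+1}=\delta(\sigma,x)\mid S_t=\sigma)=e_\sigma(x)$ for admissible $(\sigma,x)$, and the process generated by $G$ is the observable process $(X_t)_{t\in\mathbb Z}$ of the stationary joint law with $S_0\sim\pi$. The map $\delta$ is extended to words by iteration along admissible paths, $\delta(\sigma,\lambda)=\sigma$. Block laws and conditional tables. For a stationary process $P$, $P_n(w)=P(X_1^n=w)$ for $w\in\mathcal X^n$, $P_0(\lambda)=1$.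 For $L\ge1$ let $\mathcal U_L(P)=\{u\in\bigcup_{\ell=1}^L\mathcal X^\ell: P(X_{-|u|+1}^0=u)>0\}$. For $u\in\mathcal U_L(P)$ and a word $v$ with $0\le|v|\le R$ put $P(v\mid u)=P(X_1^{|v|}=v\mid X_{-|u|+1}^0=u)$, $P(\lambda\mid u)=1$. The labeled table is $C_{L,R}(P)=(P(v\mid u))_{u\in\mathcal U_L(P),\,|v|\le R}$. Equality $C_{L,R}(P)=C_{L,R}(Q)$ means $\mathcal U_L(P)=\mathcal U_L(Q)$ and $P(v\mid u)=Q(v\mid u)$ for every indexed pair $(u,v)$. Uniform identifiability. A summary $\Psi$ gives uniform identifiability on a class $\Theta$ if for all $P,Q\in\Theta$, $\Psi(P)=\Psi(Q)$ implies $G_P\cong G_Q$. Synchronization. A positive-probability word $w\in\mathcal X^m$, $m\ge0$, synchronizes to $\sigma$ if $P(S_m=\sigma\mid X_1^m=w)=1$ (conditioning on $\lambda$ is trivial). $G$ is exact if it has a finite positive-probability synchronizing word. Radii. $L_{\mathrm{tar}}(G)=\max_{\sigma\in\mathcal S}\inf\{|w|: w\text{ synchronizes to }\sigma\}$ ($\inf\emptyset=\infty$), and $L_{\mathrm{sep}}(G)=\max_{\sigma\neq\tau}\min\{|v|:p_\sigma(v)\neq p_\tau(v)\}$. For a one-state generator both radii are set to $0$. Isomorphism. $G\cong G'$ if there is a bijection $f:\mathcal S\to\mathcal S'$ with $\pi'(f(\sigma))=\pi(\sigma)$, $e'_{f(\sigma)}(x)=e_\sigma(x)$ and $\delta'(f(\sigma),x)=f(\delta(\sigma,x))$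 for every admissible $(\sigma,x)$. *)

(* Defs.v *)
From HB Require Import structures.
From mathcomp Require Import all_boot all_order all_algebra.
From mathcomp Require Import all_classical all_reals all_analysis.

Set Implicit Arguments.
Unset Strict Implicit.
Unset Printing Implicit Defensive.

Import Order.TTheory GRing.Theory Num.Theory.
Local Open Scope classical_set_scope.
Local Open Scope ring_scope.

(* Two-sided processes with values in a finite type; every subset of the
   finite value space is measurable. *)
Record process (R : realType) (V : finType) := Process {
  disp : measure_display;
  sample : measurableType disp;
  law : probability sample R;
  value : int -> sample -> V;
  value_measurable : forall (t : int) (B : set V), measurable (value t @^-1` B)
}.

Arguments value {R V} _ _ _.
Arguments value_measurable {R V} _ _ _.

Section Process.
Variables (R : realType) (V : finType) (P : process R V).

Definition prob (E : set (sample P)) : R := fine (law P E).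

Definition window (t : int) (n : nat) (o : sample P) : seq V :=
  [seq value P (t + k%:Z) o | k <- iota 0 n].

Definition occurs (t : int) (w : seq V) : set (sample P) :=
  [set o | window t (size w) o = w].

Definition stationary : Prop :=
  forall (t : int) (w : seq V), prob (occurs t w) = prob (occurs 0 w).

Definition block_law (n : nat) : {ffun n.-tuple V -> R} :=
  [ffun w : n.-tuple V => prob (occurs 1 w)].

(* The past word u occupies the times 1 - |u|, ..., 0 and the future word v
   the times 1, ..., |v|. *)
Definition past (u : seq V) : set (sample P) := occurs (1 - (size u)%:Z) u.

Definition contexts (L : nat) : set (seq V) :=
  [set u | (1 <= size u <= L)%N /\ 0 < prob (past u)].

Definition cond_prob (v u : seq V) : R :=
  prob (past u `&` occurs 1 v) / prob (past u).

End Process.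

Arguments window {R V} _ _ _ _.
Arguments occurs {R V} _ _ _ _.

Definition map_process (R : realType) (V W : finType) (f : V -> W)
    (P : process R V) : process R W :=
  @Process R W (disp P) (sample P) (law P) (fun t o => f (value P t o))
    (fun t B => value_measurable P t (f @^-1` B)).

(* Equality of laws on the product sigma-algebra, tested on cylinders. *)
Definition same_law (R : realType) (V : finType) (P Q : process R V) : Prop :=
  forall (t : int) (w : seq V), prob (occurs P t w) = prob (occurs Q t w).

Definition same_block_law (R : realType) (V : finType) (n : nat)
    (P Q : process R V) : Prop :=
  block_law P n = block_law Q n.

Definition same_table (R : realType) (V : finType) (L r : nat)
    (P Q : process R V) : Prop :=
  contexts P L = contexts Q L /\
  forall u v : seq V, contexts P L u -> (size v <= r)%N ->
    cond_prob P v u = cond_prob Q v u.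

Record machine (R : realType) (X : finType) := Machine {
  state : finType;
  init : state -> R;
  succ_state : state -> X -> option state;
  emit : state -> X -> R
}.

Section Machine.
Variables (R : realType) (X : finType) (G : machine R X).
Local Notation S := (state G).

Definition admissible (s : S) (x : X) : bool := 0 < emit s x.

Definition step (s : S) (x : X) (s' : S) : R :=
  if admissible s x && (succ_state s x == Some s') then emit s x else 0.

(* P((X_1, S_1) = p_1, ..., (X_n, S_n) = p_n | S_0 = s) *)
Fixpoint path_prob (s : S) (p : seq (X * S)) : R :=
  if p is (x, s') :: p' then step s x s' * path_prob s' p' else 1.

(* P(X_1^|w| = w | S_0 = s) *)
Definition word_prob (s : S) (w : seq X) : R :=
  \sum_(ss : (size w).-tuple S) path_prob s (zip w ss).

(* P(X_1^|w| = w) and P(X_1^|w| = w, S_|w| = s') for S_0 ~ init *)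
Definition stat_word_prob (w : seq X) : R :=
  \sum_(s : S) init s * word_prob s w.

Definition stat_word_state_prob (w : seq X) (s' : S) : R :=
  \sum_(s : S) init s *
    \sum_(ss : (size w).-tuple S | last s ss == s') path_prob s (zip w ss).

Definition transition (s s' : S) : R :=
  \sum_(x : X | admissible s x && (succ_state s x == Some s')) emit s x.

Definition edge (s s' : S) : bool :=
  [exists x : X, admissible s x && (succ_state s x == Some s')].

Definition stationary_vector (mu : S -> R) : Prop :=
  [/\ forall s, 0 <= mu s,
      \sum_(s : S) mu s = 1
    & forall s', \sum_(s : S) mu s * transition s s' = mu s'].

Record epsilon_machine : Prop := EpsilonMachine {
  state_nonempty : (0 < #|S|)%N;
  emit_ge0 : forall (s : S) (x : X), 0 <= emit s x;
  emit_sum1 : forall s : S, \sum_(x : X) emit s x = 1;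
  succ_admissible : forall (s : S) (x : X),
    isSome (succ_state s x) = admissible s x;
  strongly_connected : forall s s' : S, connect edge s s';
  state_separated : forall s s' : S, s != s' ->
    exists w : seq X, word_prob s w <> word_prob s' w;
  init_stationary : stationary_vector (@init R X G);
  init_unique : forall mu : S -> R, stationary_vector mu ->
    forall s, mu s = init s
}.

Definition synchronizes (w : seq X) (s : S) : Prop :=
  0 < stat_word_prob w /\ stat_word_state_prob w s / stat_word_prob w = 1.

Definition exact_machine : Prop := exists (w : seq X) (s : S), synchronizes w s.

(* Both radii are 0 for a one-state epsilon-machine: the empty word
   synchronizes, and there is no pair of distinct states.  An infimum over an
   empty set of lengths is +oo. *)
Definition target_radius : \bar R :=
  \big[maxe/0%E]_(s : S)
    ereal_inf [set (size w)%:R%:E | w in [set w : seq X | synchronizes w s]].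

Definition separation_radius : \bar R :=
  \big[maxe/0%E]_(ss : S * S | ss.1 != ss.2)
    ereal_inf [set (size v)%:R%:E |
      v in [set v : seq X | word_prob ss.1 v <> word_prob ss.2 v]].

(* J is the stationary joint process t |-> (X_t, S_t) of the machine. *)
Definition joint_process (J : process R (X * S)%type) : Prop :=
  forall (t : int) (s : S) (p : seq (X * S)),
    prob ([set o | (value J t o).2 = s] `&` occurs J (t + 1) p)
    = init s * path_prob s p.

Definition generates (P : process R X) : Prop :=
  exists2 J : process R (X * S)%type,
    joint_process J & same_law P (map_process fst J).

End Machine.

Definition isomorphic (R : realType) (X : finType) (G H : machine R X) : Prop :=
  exists f : state G -> state H,
    [/\ bijective f,
        forall s, init (f s) = init s,
        forall s x, emit (f s) x = emit s x
      & forall s x, admissible s x ->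
          succ_state (f s) x = omap f (succ_state s x)].

(* P belongs to the class when exact_class A D P G for some G; keeping G as an
   argument lets the conclusion speak about every generator of P. *)
Definition exact_class (R : realType) (X : finType) (A D : nat)
    (P : process R X) (G : machine R X) : Prop :=
  [/\ stationary P, epsilon_machine G /\ generates G P, exact_machine G,
      (target_radius G <= A%:R%:E)%E
    & (separation_radius G <= D%:R%:E)%E].

(* A summary enters through the relation "P and Q have the same summary". *)
Definition uniformly_identifies (R : realType) (X : finType)
    (same_summary : process R X -> process R X -> Prop)
    (Theta : process R X -> machine R X -> Prop) : Prop :=
  forall (P Q : process R X) (GP GQ : machine R X),
    Theta P GP -> Theta Q GQ -> same_summary P Q -> isomorphic GP GQ.

(* Main.v *)
(* A word synchronizing one machine, read after a word leading the other machine
   to a suitable state, synchronizes both; so every state of either machine is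
   reached by a word c of length at most 2A that synchronizes both machines.
   Each summary determines the conditional laws of short words after c, hence
   the emissions and, up to length D, the word laws at the two states reached by
   c and at their successors.  Since words of length D separate the states, the
   pairs of states reached by a common synchronizing word form the graph of an
   isomorphism. *)
Require Import Defs.
From mathcomp Require Import all_boot all_order all_algebra.
From mathcomp Require Import all_classical all_reals all_analysis.
From mathcomp Require Import zify.

Set Implicit Arguments.
Unset Strict Implicit.
Unset Printing Implicit Defensive.

Import Order.TTheory GRing.Theory Num.Theory.
Local Open Scope classical_set_scope.
Local Open Scope ring_scope.

(** * Word laws, synchronizing words and radii of a single machine *)

Section Machine.
Variables (R : realType) (X : finType) (G : machine R X).
Local Notation S := (state G).
Implicit Types (s t : S) (x : X) (u v w : seq X).

(** The admissibility guard makes the word identities below valid for an arbitrary machine; for an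
    $\epsilon$-machine the guard disappears ([next_stateE]). *)
Definition next_state s x : option S :=
  if admissible s x then succ_state s x else None.

Fixpoint run s w : option S :=
  if w is x :: w' then obind (run^~ w') (next_state s x) else Some s.

Lemma stepE s x t : step s x t = if next_state s x == Some t then emit s x else 0.
Proof. by rewrite /step /next_state; case: admissible. Qed.

Lemma sum_tupleS (T : finType) n (F : n.+1.-tuple T -> R) :
  \sum_ss F ss = \sum_(s : T) \sum_(ss : n.-tuple T) F [tuple of s :: ss].
Proof.
rewrite pair_big.
rewrite (reindex (fun p : T * n.-tuple T => [tuple of p.1 :: p.2])) //=.
exists (fun ss : n.+1.-tuple T => (thead ss, [tuple of behead ss])).
  by move=> [s ss] _ /=; rewrite theadE; congr pair; apply: val_inj.
by move=> ss _ /=; rewrite [RHS]tuple_eta; apply: val_inj.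
Qed.

Lemma word_prob_nil s : word_prob s [::] = 1.
Proof.
rewrite /word_prob (eq_bigr (fun=> 1)).
  by rewrite sumr_const card_tuple expn0.
by move=> ss _; rewrite tuple0.
Qed.

(** The state and the letter determine the next state, so only one first step in the sum over state
    paths has nonzero weight. *)
Lemma word_prob_cons s x w :
  word_prob s (x :: w) =
    if next_state s x is Some t then emit s x * word_prob t w else 0.
Proof.
have -> : word_prob s (x :: w) = \sum_t step s x t * word_prob t w.
  by rewrite /word_prob /= sum_tupleS; apply: eq_bigr => t _; rewrite mulr_sumr.
case: (next_state s x) (stepE s x) => [t|] nE.
  rewrite (bigD1 t) //= nE eqxx big1 ?addr0// => t' t't.
  by rewrite nE (inj_eq Some_inj) eq_sym (negbTE t't) mul0r.
by apply: big1 => t _; rewrite nE mul0r.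
Qed.

Lemma word_state_probE s w t :
  \sum_(ss : (size w).-tuple S | last s ss == t) path_prob s (zip w ss)
    = if run s w == Some t then word_prob s w else 0.
Proof.
elim: w s => [|x w IH] s.
  rewrite /= word_prob_nil big_mkcond (eq_bigr (fun=> (s == t)%:R)).
    by rewrite sumr_const card_tuple expn0 /= (inj_eq Some_inj); case: eqP.
  by move=> ss _; rewrite tuple0 /=; case: eqP.
rewrite big_mkcond sum_tupleS word_prob_cons /=.
transitivity (\sum_s' step s x s' *
    if run s' w == Some t then word_prob s' w else 0).
  apply: eq_bigr => s' _; rewrite -IH mulr_sumr [RHS]big_mkcond.
  by apply: eq_bigr => ss _ /=; case: ifP.
case: (next_state s x) (stepE s x) => [s'|] nE /=.
  rewrite (bigD1 s') //= nE eqxx big1 ?addr0.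
    by case: ifP; rewrite ?mulr0.
  by move=> s'' ne; rewrite nE (inj_eq Some_inj) eq_sym (negbTE ne) mul0r.
by apply: big1 => s' _; rewrite nE mul0r.
Qed.

Lemma word_prob_cat s u v :
  word_prob s (u ++ v) =
    if run s u is Some t then word_prob s u * word_prob t v else 0.
Proof.
elim: u s => [|x u IH] s /=; first by rewrite word_prob_nil mul1r.
rewrite !word_prob_cons; case: next_state => [t|] //=.
by rewrite IH; case: run => [t'|]; rewrite ?mulr0 ?mulrA.
Qed.

Lemma run_cat s u v : run s (u ++ v) = obind (run^~ v) (run s u).
Proof. by elim: u s => //= x u IH s; case: next_state => //= t; rewrite IH. Qed.

Hypothesis eG : epsilon_machine G.

Lemma emit_gt0 s x t : next_state s x = Some t -> 0 < emit s x.
Proof. by rewrite /next_state; case: ifP. Qed.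

Lemma next_stateE s x : next_state s x = succ_state s x.
Proof.
by rewrite /next_state -(succ_admissible eG); case: succ_state.
Qed.

Lemma isSome_next_state s x : isSome (next_state s x) = (0 < emit s x).
Proof. by rewrite next_stateE (succ_admissible eG). Qed.

Lemma word_prob_gt0 s w : (0 < word_prob s w) = isSome (run s w).
Proof.
elim: w s => [|x w IH] s /=; first by rewrite word_prob_nil ltr01.
rewrite word_prob_cons; case n: next_state => [t|] /=; last by rewrite ltxx.
by rewrite pmulr_rgt0 ?IH// (emit_gt0 n).
Qed.

Lemma word_prob_ge0 s w : 0 <= word_prob s w.
Proof.
elim: w s => [|x w IH] s /=; first by rewrite word_prob_nil ler01.
rewrite word_prob_cons; case n: next_state => [t|] //=.
by rewrite mulr_ge0 ?IH// ltW// (emit_gt0 n).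
Qed.

Lemma word_prob1 s x : word_prob s [:: x] = emit s x.
Proof.
rewrite word_prob_cons; case n: next_state => [t|].
  by rewrite word_prob_nil mulr1.
apply/eqP; rewrite eq_le (emit_ge0 eG) leNgt andbC /=.
by rewrite -isSome_next_state n.
Qed.

Lemma exists_letter s : exists x, 0 < emit s x.
Proof.
case: (pickP (fun x => 0 < emit s x)) => [x ?|h]; first by exists x.
have := emit_sum1 eG s; rewrite big1 => [/eqP|x _].
  by rewrite eq_sym oner_eq0.
by apply/eqP; rewrite eq_le (emit_ge0 eG) leNgt h.
Qed.

Lemma transition_ge0 s t : 0 <= transition s t.
Proof. by apply: sumr_ge0 => x _; apply: emit_ge0. Qed.

Lemma transition_gt0 s t : edge s t -> 0 < transition s t.
Proof.
case/existsP => x xP; rewrite /transition (bigD1 x)//=.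
rewrite ltr_pwDl ?sumr_ge0//; first by case/andP: xP.
by move=> y _; apply: emit_ge0.
Qed.

(* The zero set of a stationary vector is closed under predecessors, so by
   strong connectivity it is empty. *)
Lemma init_gt0 s : 0 < init s.
Proof.
have [i0 i1 iT] := init_stationary eG.
have [s0 s00] : exists s0, 0 < init s0.
  case: (pickP (fun s => 0 < init s)) => [x ?|h]; first by exists x.
  move/eqP: i1; rewrite big1 ?(eq_sym 0) ?oner_eq0// => t _.
  by apply/eqP; rewrite eq_le i0 leNgt h.
case/connectP: (strongly_connected eG s0 s) => p.
elim: p s0 s00 => [|t p IH] s0 s00 /=; first by move=> _ ->.
case/andP => e /(IH t); apply.
rewrite -iT (bigD1 s0)//= ltr_pwDl ?mulr_gt0 ?transition_gt0 ?sumr_ge0//.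
by move=> s' _; rewrite mulr_ge0 ?transition_ge0.
Qed.

(** Every initial weight is positive, so one state able to read [w] is enough. *)
Lemma stat_word_prob_gt0 w :
  0 < stat_word_prob G w <-> exists s, 0 < word_prob s w.
Proof.
split=> [|[s s0]].
  move=> p; apply: contrapT => h; move: p.
  rewrite /stat_word_prob big1 ?ltxx// => s _.
  rewrite (_ : word_prob s w = 0) ?mulr0//.
  apply/eqP; rewrite eq_le word_prob_ge0 andbT leNgt; apply/negP => ?.
  by apply: h; exists s.
rewrite /stat_word_prob (bigD1 s)//= ltr_pwDl ?mulr_gt0 ?init_gt0 ?sumr_ge0//.
by move=> t _; rewrite mulr_ge0 ?word_prob_ge0// ltW ?init_gt0.
Qed.

Lemma stat_word_prob_nil : stat_word_prob G [::] = 1.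
Proof.
have [_ <- _] := init_stationary eG.
by apply: eq_bigr => s _; rewrite word_prob_nil mulr1.
Qed.

(** Emissions sum to 1 at whatever state [w] reaches. This lets a block law determine the laws of
    all shorter blocks. *)
Lemma sum_stat_word_prob_rcons w :
  \sum_x stat_word_prob G (rcons w x) = stat_word_prob G w.
Proof.
rewrite /stat_word_prob exchange_big; apply: eq_bigr => s _ /=.
rewrite -mulr_sumr; congr (_ * _).
under eq_bigr => x _ do rewrite -cats1 word_prob_cat.
case r: (run s w) => [t|].
  under eq_bigr => x _ do rewrite word_prob1.
  by rewrite -mulr_sumr (emit_sum1 eG) mulr1.
rewrite big1//; apply/esym/eqP; rewrite eq_le word_prob_ge0 leNgt word_prob_gt0.
by rewrite r.
Qed.

(** Turns a conditional probability into a statement about runs. The defect $P(w)-P(w,S_{|w|}=s)$ is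
    a sum of nonnegative terms with positive initial weights, so it vanishes exactly when no state
    reads [w] and ends elsewhere than in [s]. *)
Lemma synchronizesP w s :
  synchronizes w s <->
  [/\ exists t, isSome (run t w) & forall t, run t w -> run t w = Some s].
Proof.
rewrite /synchronizes stat_word_prob_gt0.
under eq_exists do rewrite word_prob_gt0.
have E : stat_word_prob G w - stat_word_state_prob w s
    = \sum_t init t * (if run t w == Some s then 0 else word_prob t w).
  rewrite -sumrB; apply: eq_bigr => t _.
  rewrite -mulrBr word_state_probE.
  by case: ifP; rewrite ?subrr ?subr0.
split=> [[[t tw] /eqP h]|[[t tw] h]].
  split; first by exists t.
  have p0 : stat_word_prob G w != 0.
    by rewrite gt_eqF//; apply/stat_word_prob_gt0; exists t; rewrite word_prob_gt0.
  move: h; rewrite -subr_eq0 -[1](divff p0) -mulrBl mulf_eq0 invr_eq0 (negbTE p0).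
  rewrite orbF -oppr_eq0 opprB E psumr_eq0 => [/allP h|t' _].
    move=> t' t'w; have := h t' (mem_index_enum _) => /=.
    case: (run t' w =P Some s) => //= _ /eqP e0.
    by have := word_prob_gt0 t' w; rewrite t'w -(pmulr_rgt0 _ (init_gt0 t')) e0 ltxx.
  by apply: mulr_ge0; [exact/ltW/init_gt0|case: ifP => // _; exact: word_prob_ge0].
split; first by exists t.
have p0 : stat_word_prob G w != 0.
  by rewrite gt_eqF//; apply/stat_word_prob_gt0; exists t; rewrite word_prob_gt0.
apply/eqP; rewrite -subr_eq0 -[X in _ - X](divff p0) -mulrBl mulf_eq0 invr_eq0.
rewrite (negbTE p0) orbF -oppr_eq0 opprB E big1// => t' _.
case: eqP => [|ne]; rewrite ?mulr0//.
rewrite (_ : word_prob t' w = 0) ?mulr0//; apply/eqP.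
rewrite eq_le word_prob_ge0 leNgt andbT word_prob_gt0; apply/negP => /h.
exact: ne.
Qed.

Lemma synchronizes_gt0 w s : synchronizes w s -> 0 < stat_word_prob G w.
Proof. by case. Qed.

(** Every start that survives [w] is at [s], so the law of what follows is the word law at [s]. This
    is how observable data reach a hidden state. *)
Lemma stat_word_prob_cat w s v : synchronizes w s ->
  stat_word_prob G (w ++ v) = stat_word_prob G w * word_prob s v.
Proof.
case/synchronizesP=> _ h; rewrite /stat_word_prob mulr_suml.
apply: eq_bigr => t _; rewrite word_prob_cat -mulrA; congr (_ * _).
case r: (run t w) => [t'|]; first by move: (h t); rewrite r => /(_ isT) [->].
suff -> : word_prob t w = 0 by rewrite mul0r.
by apply/eqP; rewrite eq_le word_prob_ge0 leNgt word_prob_gt0 r.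
Qed.

(** A prefix only restricts the states from which [w] is read; positivity has to be assumed because
    the concatenation may be unreadable. *)
Lemma synchronizes_catr u w s : synchronizes w s ->
  0 < stat_word_prob G (u ++ w) -> synchronizes (u ++ w) s.
Proof.
case/synchronizesP=> _ h /stat_word_prob_gt0[t]; rewrite word_prob_gt0 => tw.
apply/synchronizesP; split; first by exists t.
move=> t'; rewrite run_cat; case: run => //= t'' ; exact: h.
Qed.

Lemma synchronizes_catl u w s t : synchronizes u s -> run s w = Some t ->
  synchronizes (u ++ w) t.
Proof.
case/synchronizesP=> [[s' s'u] h] st; apply/synchronizesP; split.
  by exists s'; rewrite run_cat (h _ s'u) /= st.
by move=> t'; rewrite run_cat; case r: run => //=; move: (h t'); rewrite r => /(_ isT)[->].
Qed.

Lemma synchronizes_nil s t : synchronizes [::] s -> t = s.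
Proof. by case/synchronizesP => _ /(_ t isT) []. Qed.

Lemma target_radius_le (A : nat) s : (target_radius G <= A%:R%:E)%E ->
  exists2 w, (size w <= A)%N & synchronizes w s.
Proof.
move=> /bigmax_leP[_ /(_ s isT)] h.
(* Lengths are integers: an infimum at most $A$ is strictly below $A+1$, so some length is below
   $A+1$, and attainment need not be discussed. *)
have /ereal_inf_lt[_ [w ws <-]] : (ereal_inf [set (size w)%:R%:E | w in
  [set w : seq X | synchronizes w s]] < (A.+1)%:R%:E :> \bar R)%E.
  by apply: le_lt_trans h _; rewrite lte_fin ltr_nat.
by rewrite lte_fin ltr_nat ltnS => ?; exists w.
Qed.

Lemma separation_radius_le (D : nat) s t :
  (separation_radius G <= D%:R%:E)%E ->
  (forall v, (size v <= D)%N -> word_prob s v = word_prob t v) -> s = t.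
Proof.
move=> /bigmax_leP[_ h] e; apply/eqP/negP => /negP st.
have hst := h (s, t) st.
have /ereal_inf_lt[_ [w ws <-]] : (ereal_inf [set (size v)%:R%:E | v in
  [set v : seq X | word_prob s v <> word_prob t v]] < (D.+1)%:R%:E :> \bar R)%E.
  by apply: le_lt_trans hst _; rewrite lte_fin ltr_nat.
by rewrite lte_fin ltr_nat ltnS => /e.
Qed.

End Machine.

(** * Cylinder events of a process and their probabilities under a generating machine *)

Section Process.
Variables (R : realType) (V : finType) (P : process R V).

Lemma windowS t n (o : sample P) :
  window P t n.+1 o = value P t o :: window P (t + 1) n o.
Proof.
rewrite /window /= addr0; congr cons.
rewrite (iotaDl 1 0) -map_comp; apply: eq_map => k /=.
by rewrite add1n -addrA -intS.
Qed.

Lemma windowD t m n (o : sample P) :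
  window P t (m + n) o = window P t m o ++ window P (t + m%:Z) n o.
Proof.
elim: m t => [|m IH] t; first by rewrite addr0.
by rewrite addSn !windowS IH -addrA -intS.
Qed.

Lemma size_window t n (o : sample P) : size (window P t n o) = n.
Proof. by rewrite size_map size_iota. Qed.

Lemma occurs_cat t u v :
  occurs P t (u ++ v) = occurs P t u `&` occurs P (t + (size u)%:Z) v.
Proof.
apply/seteqP; split=> o; rewrite /occurs /= size_cat windowD.
  by move/eqP; rewrite eqseq_cat ?size_window// => /andP[/eqP ? /eqP].
by case=> -> ->.
Qed.

Lemma occurs_nil t : occurs P t [::] = setT.
Proof. by apply/seteqP; split. Qed.

Lemma measurable_occurs t w : measurable (occurs P t w).
Proof.
elim: w t => [|x w IH] t; first by rewrite occurs_nil.
rewrite (_ : occurs P t (x :: w) =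
  value P t @^-1` [set x] `&` occurs P (t + 1) w).
  by apply: measurableI => //; exact: value_measurable.
apply/seteqP; split=> o; rewrite /occurs /= windowS.
  by case=> -> ->.
by case=> -> ->.
Qed.

Lemma prob_total (I : finType) (f : sample P -> I) (E : set (sample P)) :
  (forall i, measurable (E `&` f @^-1` [set i])) ->
  prob E = \sum_i prob (E `&` f @^-1` [set i]).
Proof.
move=> mf; rewrite /prob sum_fine => [|i _]; last exact: fin_num_measure.
have EU : E = \bigcup_(i in [set` index_enum I]) (E `&` f @^-1` [set i]).
  apply/seteqP; split=> [y Ey|y [i _ []]] //.
  by exists (f y) => //=; exact: mem_index_enum.
rewrite {1}EU measure_fin_bigcup//; first by rewrite -fsbig_seq// index_enum_uniq.
by move=> i j _ _ [y [[_ <-] [_ <-]]].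
Qed.

Lemma block_lawE n (w : n.-tuple V) : block_law P n w = prob (occurs P 1 w).
Proof. by rewrite ffunE. Qed.

Lemma past_occurs u v :
  @past R V P u `&` occurs P 1 v = occurs P (1 - (size u)%:Z) (u ++ v).
Proof. by rewrite occurs_cat subrK. Qed.

End Process.

Lemma window_map (R : realType) (V W : finType) (f : V -> W)
    (P : process R V) t n (o : sample P) :
  window (map_process f P) t n o = map f (window P t n o).
Proof. by rewrite /window -map_comp. Qed.

Lemma generates_prob (R : realType) (X : finType) (G : machine R X)
    (P : process R X) : generates G P ->
  forall t w, prob (occurs P t w) = stat_word_prob G w.
Proof.
case=> J jJ PJ t w; rewrite PJ {PJ}.
(* The state paired with a letter is the one entered by emitting it, so the starting state of the
   window is read at time $t-1$. Splitting by all hidden states gives the terms of the path sum. *)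
pose f (o : sample J) : state G * (size w).-tuple (state G) :=
  ((value J (t - 1) o).2,
   [tuple of map snd (window J t (size w) o)]).
have fE i : occurs (map_process fst J) t w `&` f @^-1` [set i] =
   [set o | (value J (t - 1) o).2 = i.1] `&` occurs J (t - 1 + 1) (zip w i.2).
  case: i => s ss; rewrite subrK; apply/seteqP; split => o; rewrite /occurs /=.
    rewrite size_zip size_tuple minnn => -[].
    rewrite window_map => ew [<- <-]; split => //.
    by rewrite -[LHS]zip_unzip {1}/unzip1 ew.
  rewrite size_zip size_tuple minnn window_map => -[<- e]; split.
    by rewrite e -/unzip1 unzip1_zip// size_tuple.
  congr pair; apply: val_inj; rewrite /= e.
  by rewrite -/unzip2 unzip2_zip// size_tuple.
have mf i : measurable (occurs (map_process fst J) t w `&` f @^-1` [set i]).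
  rewrite fE; apply: measurableI; last exact: measurable_occurs.
  exact: (value_measurable J (t - 1) [set y | y.2 = i.1]).
have fP i : prob (occurs (map_process fst J) t w `&` f @^-1` [set i])
    = init i.1 * path_prob i.1 (zip w i.2) by rewrite fE; exact: jJ.
rewrite (prob_total mf) (eq_bigr _ (fun i _ => fP i)).
rewrite -(pair_bigA _ (fun s (ss : (size w).-tuple _) => init s * path_prob s (zip w ss)))/=.
by apply: eq_bigr => s _; rewrite mulr_sumr.
Qed.

(** * An isomorphism from common synchronizing words *)

Section Identification.
Variables (R : realType) (X : finType) (A D : nat).
Implicit Types G H : machine R X.

(* A word u leading G to the state from which it reads w, followed by a word w
   synchronizing H, synchronizes both machines: G because u does, H because w
   does. *)
Lemma common_synchronizing_word G H (t : state H) :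
  epsilon_machine G -> epsilon_machine H ->
  (target_radius G <= A%:R%:E)%E -> (target_radius H <= A%:R%:E)%E ->
  (forall w, (size w <= 2 * A)%N ->
     0 < stat_word_prob G w <-> 0 < stat_word_prob H w) ->
  exists s c, [/\ (size c <= 2 * A)%N, @synchronizes R X G c s
                & @synchronizes R X H c t].
Proof.
move=> eG eH tG tH GH.
have [w wA wt] := target_radius_le t tH.
have /(stat_word_prob_gt0 eG)[r] : 0 < stat_word_prob G w.
  by apply/GH; [lia|exact: synchronizes_gt0 wt].
rewrite word_prob_gt0//; case rs: (run r w) => [s|]// _.
have [u uA ur] := target_radius_le r tG.
have us := synchronizes_catl eG ur rs.
exists s, (u ++ w); split => //; first by rewrite size_cat; lia.
apply: synchronizes_catr => //; apply/GH; first by rewrite size_cat; lia.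
exact: synchronizes_gt0 us.
Qed.

(** Length [maxn 1 D] includes single letters, hence the emissions, even when $D=0$. Successors are
    a separate hypothesis because [c] followed by a letter may have length $2A+1$. *)
Lemma isomorphic_of_common_words G H :
  epsilon_machine G -> epsilon_machine H ->
  (target_radius G <= A%:R%:E)%E -> (target_radius H <= A%:R%:E)%E ->
  (separation_radius G <= D%:R%:E)%E -> (separation_radius H <= D%:R%:E)%E ->
  (forall w, (size w <= 2 * A)%N ->
     0 < stat_word_prob G w <-> 0 < stat_word_prob H w) ->
  (forall c (s : state G) (t : state H), (size c <= 2 * A)%N ->
     synchronizes c s -> synchronizes c t ->
     (forall v, (size v <= maxn 1 D)%N -> word_prob s v = word_prob t v) /\
     (forall x s' t', next_state s x = Some s' -> next_state t x = Some t' ->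
        forall v, (size v <= D)%N -> word_prob s' v = word_prob t' v)) ->
  isomorphic G H.
Proof.
move=> eG eH tG tH sG sH GH cGH.
(* The maps [f] and [g] are chosen independently, each from arbitrary common words; they turn out to
   be inverse because both preserve word laws up to length $D$, which separate the states. *)
have /choice[f fP] : forall s : state G, exists t : state H, exists c,
    [/\ (size c <= 2 * A)%N, synchronizes c s & synchronizes c t].
  move=> s; have [] := @common_synchronizing_word H G s => //.
    by move=> w /GH; tauto.
  by move=> t [c [? ? ?]]; exists t, c.
have /choice[g gP] : forall t : state H, exists s : state G, exists c,
    [/\ (size c <= 2 * A)%N, synchronizes c s & synchronizes c t].
  by move=> t; exact: common_synchronizing_word.
have fE s v : (size v <= maxn 1 D)%N -> word_prob (f s) v = word_prob s v.
  by have [c [cA cs ct]] := fP s; have [h _] := cGH _ _ _ cA cs ct => /h ->.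
have gE t v : (size v <= maxn 1 D)%N -> word_prob (g t) v = word_prob t v.
  by have [c [cA cs ct]] := gP t; have [h _] := cGH _ _ _ cA cs ct => /h ->.
have fK : cancel f g.
  move=> s; apply: (separation_radius_le sG) => v vD.
  by rewrite gE ?fE//; lia.
have gK : cancel g f.
  move=> t; apply: (separation_radius_le sH) => v vD.
  by rewrite fE ?gE//; lia.
have fem s x : emit (f s) x = emit s x by rewrite -!word_prob1// fE//=; lia.
(* Equal emissions make both successors defined together; the successor of [f s] and the image of
   the successor of [s] then agree on words of length at most $D$. *)
have fsucc s x : succ_state (f s) x = omap f (succ_state s x).
  rewrite -!next_stateE//; have := isSome_next_state eH (f s) x; rewrite fem -isSome_next_state//.
  case ns: (next_state s x) => [s'|]; case nt: (next_state (f s) x) => [t'|]//= _.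
  congr Some; apply: (separation_radius_le sH) => v vD; rewrite fE; last lia.
  have [c [cA cs ct]] := fP s; have [_ h] := cGH _ _ _ cA cs ct.
  by rewrite (h _ _ _ ns nt).
have fbij : bijective f by exists g.
have fT s s' : transition (f s) (f s') = transition s s'.
  apply: eq_big => x; last by rewrite fem.
  rewrite /admissible fem fsucc; case: (succ_state s x) => [s''|]//=.
  by rewrite !(inj_eq Some_inj) (inj_eq (can_inj fK)).
exists f; split => // s.
(* The initial vector of [G] transported along [g] is stationary for [H], so uniqueness identifies
   it with that of [H]. *)
have [i0 i1 iT] := init_stationary eG.
rewrite -[RHS](congr1 _ (fK s)) -(@init_unique _ _ _ eH (fun t => init (g t)))//.
split => [t||t] //.
  rewrite (reindex f); last exact: onW_bij.
  by rewrite -i1; apply: eq_bigr => s' _; rewrite fK.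
rewrite -iT (reindex f); last exact: onW_bij.
by apply: eq_bigr => s' _; rewrite fK -fT gK.
Qed.

End Identification.

(** * What tables and block laws determine *)

Section Summaries.
Variables (R : realType) (X : finType).
Variables (P Q : process R X) (G H : machine R X).
Hypotheses (eG : epsilon_machine G) (eH : epsilon_machine H).

(** Dividing the probability of [x :: v] by the common positive emission of [x] leaves the word law
    at the successor, at the cost of one letter of length. *)
Lemma eq_word_prob_next (n : nat) (s : state G) (t : state H) :
  (forall v, (size v <= n.+1)%N -> word_prob s v = word_prob t v) ->
  forall x s' t', next_state s x = Some s' -> next_state t x = Some t' ->
  forall v, (size v <= n)%N -> word_prob s' v = word_prob t' v.
Proof.
move=> st x s' t' ss' tt' v vn.
have ex : emit s x = emit t x by rewrite -!word_prob1// st.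
have := st (x :: v) vn; rewrite !word_prob_cons ss' tt' ex.
by apply: mulfI; rewrite gt_eqF// (emit_gt0 tt').
Qed.

Hypotheses (gP : generates G P) (gQ : generates H Q).

Lemma eq_stat_word_prob_of_block_law n w : same_block_law n P Q ->
  (size w <= n)%N -> stat_word_prob G w = stat_word_prob H w.
Proof.
(* Induction on the number [k] of letters missing from a full block; each step sums over one
   appended letter. *)
move=> PQ wn; have [k kn] : exists k, (k + size w = n)%N.
  by exists (n - size w)%N; rewrite subnK.
elim: k w kn {wn} => [|k IH] w kn.
  have wn : size w == n by rewrite -kn.
  have := congr1 (fun b : {ffun _ -> _} => b (Tuple wn)) PQ.
  by rewrite !block_lawE (generates_prob gP) (generates_prob gQ).
rewrite -!sum_stat_word_prob_rcons//; apply: eq_bigr => x _.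
by apply: IH; rewrite size_rcons -addSnnS.
Qed.

Lemma prob_past (P' : process R X) (G' : machine R X) u :
  generates G' P' -> prob (@past R X P' u) = stat_word_prob G' u.
Proof. by move=> gP'; rewrite /past (generates_prob gP'). Qed.

Variables (L r : nat).
Hypotheses (L_gt0 : (0 < L)%N) (PQ : same_table L r P Q).

Lemma table_stat_word_prob_gt0 w : (size w <= L)%N ->
  0 < stat_word_prob G w <-> 0 < stat_word_prob H w.
Proof.
(* The empty word is not a context, but it has probability 1 in both machines. *)
case: w => [|x w] wL; first by rewrite !stat_word_prob_nil.
have : contexts P L (x :: w) <-> contexts Q L (x :: w) by rewrite PQ.1.
rewrite /contexts /= wL (prob_past _ gP) (prob_past _ gQ).
by case=> PQw QPw; split=> h; [case: PQw|case: QPw].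
Qed.

Lemma table_word_prob_cons x c (s : state G) (t : state H) v :
  (size (x :: c) <= L)%N -> synchronizes (x :: c) s ->
  synchronizes (x :: c) t -> (size v <= r)%N -> word_prob s v = word_prob t v.
Proof.
move=> cL cs ct vr.
have Gc := synchronizes_gt0 cs; have Hc := synchronizes_gt0 ct.
have uP : contexts P L (x :: c) by split => //; rewrite (prob_past _ gP).
have := PQ.2 _ v uP vr; rewrite /cond_prob !past_occurs !(generates_prob gP).
rewrite !(generates_prob gQ).
rewrite (stat_word_prob_cat eG _ cs) (stat_word_prob_cat eH _ ct).
by rewrite !(mulrC _ (word_prob _ _)) !mulfK ?gt_eqF.
Qed.

(* When the empty word synchronizes, it is not a context, but there is a single
   state and any admissible letter synchronizes as well. *)
Lemma table_word_prob c (s : state G) (t : state H) v :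
  (size c <= L)%N -> synchronizes c s -> synchronizes c t -> (size v <= r)%N ->
  word_prob s v = word_prob t v.
Proof.
case: c => [_ sG tH|x c]; last exact: table_word_prob_cons.
have [x] := exists_letter eG s; rewrite -isSome_next_state//.
case sx: next_state => [s'|]// _; have s's := synchronizes_nil eG s' sG; subst s'.
have xs : synchronizes [:: x] s by apply: (synchronizes_catl eG sG); rewrite /= sx.
(* The letter was found in [G]; the contexts of length 1, available since [L] is positive, make it
   possible in [H] too. *)
have : 0 < stat_word_prob H [:: x].
  by apply/table_stat_word_prob_gt0 => //; exact: synchronizes_gt0 xs.
case/(stat_word_prob_gt0 eH) => t0; rewrite word_prob_gt0// (synchronizes_nil eH t0 tH).
case tx: run => [t'|]// _; rewrite (synchronizes_nil eH t' tH) in tx.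
exact: table_word_prob_cons xs (synchronizes_catl eH tH tx).
Qed.

End Summaries.

Theorem corollary5p4 (R : realType) (X : finType) (hX : (0 < #|X|)%N)
    (A D : nat) :
  [/\ uniformly_identifies (same_table (2 * A + 1)%N (maxn 1 D))
        (@exact_class R X A D),
      uniformly_identifies (same_table (maxn 1 (2 * A)) (D + 1)%N)
        (@exact_class R X A D)
    & uniformly_identifies (same_block_law (2 * A + D + 1)%N)
        (@exact_class R X A D)].
Proof.
split=> P Q G H [_ [eG gP] _ tG sG] [_ [eH gQ] _ tH sH] PQ;
  apply: (isomorphic_of_common_words eG eH tG tH sG sH).
- by move=> w wA; apply: (table_stat_word_prob_gt0 eG eH gP gQ PQ); lia.
- move=> c s t cA cs ct; split=> [v vD|x s' t' ss' tt' v vD].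
    by apply: (table_word_prob eG eH gP gQ _ PQ _ cs ct) => //; lia.
  (* The extra unit of context length is spent here: [c] extended by [x] synchronizes both machines
     to the two successors. *)
  apply: (table_word_prob eG eH gP gQ _ PQ (c := c ++ [:: x])); try lia.
  + by rewrite size_cat /=; lia.
  + by apply: (synchronizes_catl eG cs); rewrite /= ss'.
  + by apply: (synchronizes_catl eH ct); rewrite /= tt'.
- by move=> w wA; apply: (table_stat_word_prob_gt0 eG eH gP gQ PQ); lia.
- move=> c s t cA cs ct.
  (* Here the extra unit lies in the future length instead, and [eq_word_prob_next] spends it on the
     letter leading to the successors. *)
  have st v : (size v <= D.+1)%N -> word_prob s v = word_prob t v.
    by move=> vD; apply: (table_word_prob eG eH gP gQ _ PQ _ cs ct); lia.
  split; last exact: eq_word_prob_next.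
  by move=> v vD; apply: st; lia.
- move=> w wA; rewrite (eq_stat_word_prob_of_block_law eG eH gP gQ PQ)//.
  by lia.
- move=> c s t cA cs ct.
  have st v : (size v <= D.+1)%N -> word_prob s v = word_prob t v.
    (* The block length $2A+D+1$ is what [c ++ v] needs; cancelling the common positive probability
       of [c] leaves the word laws at [s] and [t]. *)
    move=> vD; have := @eq_stat_word_prob_of_block_law _ _ _ _ _ _ eG eH gP gQ _
      (c ++ v) PQ.
    rewrite (stat_word_prob_cat eG _ cs) (stat_word_prob_cat eH _ ct).
    rewrite (eq_stat_word_prob_of_block_law eG eH gP gQ PQ); last lia.
    rewrite size_cat => e; apply: mulfI (e _); last lia.
    by rewrite gt_eqF// (synchronizes_gt0 ct).
  split; last exact: eq_word_prob_next.
  by move=> v vD; apply: st; lia.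
Qed.
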